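(* Let $B$ be a Banach space and $D$ a nonempty closed convex subset of $B$. Let $T:D\to D$ be a contraction, i.e. there is $\delta\in(0,1)$ such that $\|Tx-Ty\|\le\delta\|x-y\|$ for all $x,y\in D$. Let $\varepsilon>0$ be fixed and let $\widetilde T:D\to D$ be an approximate operator of $T$, i.e. $\|Tx-\widetilde Tx\|\le\varepsilon$ for all $x\in D$. Let $\{\eta_n^1\}_{n=0}^\infty$ and $\{\eta_n^2\}_{n=0}^\infty$ be real sequences in $[0,1]$ satisfying (i) $\frac12\le\eta_n^1\eta_n^2$ for all $n\in\mathbb{N}$, and (ii) $\sum_{n=0}^\infty\eta_n^1\eta_n^2=\infty$. Let $x_0\in D$ and let $\{x_n\}_{n=0}^\infty$ be generated by the Picard-S iteration for $T$, $$x_{n+1}=Ty_n,\qquad y_n=(1-\eta_n^1)Tx_n+\eta_n^1Tz_n,\qquad z_n=(1-\eta_n^2)x_n+\eta_n^2Tx_n,\qquad n\in\mathbb{N},$$ and let $\widetilde x_0\in D$ and $\{\widetilde x_n\}_{n=0}^\infty$ be defined by $$\widetilde x_{n+1}=\widetilde T\widetilde y_n,\qquad \widetilde y_n=(1-\eta_n^1)\widetilde T\widetilde x_n+\eta_n^1\widetilde T\widetilde z_n,\qquad \widetilde z_n=(1-\eta_n^2)\widetilde x_n+\eta_n^2\widetilde T\widetilde x_n,\qquad n\in\mathbb{N}.$$ If $Tx_*=x_*$ and $\widetilde T\widetilde x_*=\widetilde x_*$ (with $x_*,\widetilde x_*\in D$) are such that $\widetilde x_n\to\widetilde x_*$ as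 $n\to\infty$, then $$\|x_*-\widetilde x_*\|\le\frac{5\varepsilon}{1-\delta}.$$
   Context: $\mathbb{N}$ denotes the set of nonnegative integers $\{0,1,2,\dots\}$. The superscripts in $\eta_n^1,\eta_n^2$ are indices, not powers. *)

(* Defs.v *)
From HB Require Import structures.
From mathcomp Require Import all_boot all_order all_algebra.
From mathcomp Require Import all_classical all_reals all_analysis.

Set Implicit Arguments.
Unset Strict Implicit.
Unset Printing Implicit Defensive.

Import Order.TTheory GRing.Theory Num.Theory.
Import numFieldNormedType.Exports.

Local Open Scope classical_set_scope.
Local Open Scope ring_scope.

Section picardS.
Context {R : realType} {B : normedModType R}.

(* Operators on D are total functions on B that map D into D; their values
   outside D are irrelevant. *)
Definition approximate_operator (D : set B) (eps : R) (T T' : {fun D >-> D}) :=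
  forall x : B, D x -> `|T x - T' x| <= eps.

Definition picardS_iteration (T : B -> B) (eta1 eta2 : nat -> R)
    (x y z : nat -> B) :=
  forall n : nat,
    [/\ x n.+1 = T (y n),
        y n = (1 - eta1 n) *: T (x n) + eta1 n *: T (z n) &
        z n = (1 - eta2 n) *: x n + eta2 n *: T (x n)].

End picardS.

(* Main.v *)
(* The fixed point xs' of T' satisfies
   |xs - xs'| <= |T xs - T xs'| + |T xs' - T' xs'| <= delta |xs - xs'| + eps,
   so that even |xs - xs'| <= eps / (1 - delta). *)
Require Import Defs.
From HB Require Import structures.
From mathcomp Require Import all_boot all_order all_algebra.
From mathcomp Require Import all_classical all_reals all_analysis.
From mathcomp Require Import lra.

Import Order.TTheory GRing.Theory Num.Theory.
Import numFieldNormedType.Exports.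

Local Open Scope classical_set_scope.
Local Open Scope ring_scope.

Theorem theorem4 (R : realType) (B : completeNormedModType R)
  (D : set B) (D_neq0 : D !=set0) (D_closed : closed D)
  (D_convex : convex_set D)
  (T : {fun D >-> D}) (delta : {nonneg R}) (delta_gt0 : 0 < delta%:num)
  (T_contraction : contraction delta T)
  (eps : R) (eps_gt0 : 0 < eps)
  (T' : {fun D >-> D}) (T'_approx : approximate_operator eps T T')
  (eta1 eta2 : nat -> R)
  (eta1_01 : forall n : nat, 0 <= eta1 n <= 1)
  (eta2_01 : forall n : nat, 0 <= eta2 n <= 1)
  (eta_ge_half : forall n : nat, 1 / 2 <= eta1 n * eta2 n)
  (eta_series : (\sum_(0 <= n <oo) (eta1 n * eta2 n)%:E = +oo)%E)
  (x y z : nat -> B) (x0_in_D : D (x 0%N))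
  (x_iter : picardS_iteration T eta1 eta2 x y z)
  (x' y' z' : nat -> B) (x'0_in_D : D (x' 0%N))
  (x'_iter : picardS_iteration T' eta1 eta2 x' y' z')
  (xs xs' : B) (xs_in_D : D xs) (xs'_in_D : D xs')
  (xs_fixed : T xs = xs) (xs'_fixed : T' xs' = xs')
  (x'_cvg : x' @ \oo --> xs') :
  `|xs - xs'| <= 5 * eps / (1 - delta%:num).
Proof.
have [delta_lt1 T_lip] := T_contraction.
have T_le : `|T xs - T xs'| <= delta%:num * `|xs - xs'|.
  (* The Lipschitz bound in [contraction] quantifies over pairs in the product of [D] with itself,
     so [split] asks for membership of both fixed points in [D]. *)
  by have := T_lip (xs, xs'); apply; split.
have dist_le : `|xs - xs'| <= delta%:num * `|xs - xs'| + eps.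
  (* Each point is replaced by its image only on the left, and [T xs'] is inserted as midpoint: one
     gap is controlled by contractivity of [T], the other by the closeness of [T'] to [T] at
     [xs']. *)
  rewrite -{1}xs_fixed -{1}xs'_fixed -(subrKA (T xs')).
  apply: le_trans (ler_normD _ _) _.
  exact: lerD T_le (T'_approx _ xs'_in_D).
(* With [1 - delta%:num] positive, clearing the denominator and absorbing the contracted term leaves
   the bound [eps], which is below [5 * eps] since [eps] is positive. *)
rewrite ler_pdivlMr ?subr_gt0//; lra.
Qed.
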